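(* Let $G$ be a finite simple graph with stability number $\alpha(G)\leq 3$, and let $G^{\ast}$ be the graph obtained from $G$ by appending a single pendant edge to each vertex of $G$. Then the independence polynomial $I(G^{\ast};x)$ is log-concave.
   Context: All graphs are finite, undirected, without loops or multiple edges, and have at least one vertex. A stable set in a graph $G$ is a set of pairwise non-adjacent vertices; the stability number $\alpha(G)$ is the maximum size of a stable set in $G$. Let $s_k$ be the number of stable sets of cardinality $k$ in $G$ (so $s_0=1$); the independence polynomial of $G$ is $I(G;x)=\sum_{k=0}^{\alpha(G)}s_kx^k$. The graph $G^{\ast}$ is obtained from $G$ by adding, for each vertex $v$ of $G$, one new vertex $v'$ joined only to $v$. A finite sequence of real numbers $(a_0,a_1,\dots,a_n)$ is log-concave if $a_i^2\geq a_{i-1}a_{i+1}$ for all $1\leq i\leq n-1$; a polynomial is log-concave if its sequence of coefficients is log-concave. *)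

(* Defs.v *)
From HB Require Import structures.
From mathcomp Require Import all_boot all_order all_algebra.
Set Implicit Arguments.
Unset Strict Implicit.
Unset Printing Implicit Defensive.
Import Order.TTheory GRing.Theory Num.Theory.
Local Open Scope ring_scope.

Record graph := Graph {
  vertex :> finType;
  edge : rel vertex;
  edge_sym : symmetric edge;
  edge_irr : irreflexive edge;
  vertex_nonempty : (0 < #|vertex|)%N
}.
Arguments edge {g} x y.

Definition stable (G : graph) (S : {set G}) : bool :=
  [forall u in S, forall v in S, ~~ edge u v].

Definition stability_number (G : graph) : nat :=
  \max_(S : {set G} | stable S) #|S|.

Definition num_stable (G : graph) (k : nat) : nat :=
  #|[set S : {set G} | stable S & #|S| == k]|.

Definition independence_poly (R : realDomainType) (G : graph) : {poly R} :=
  \poly_(k < (stability_number G).+1) (num_stable G k)%:R.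

Section Pendant.
Variable G : graph.

(* [inl v] is the vertex v of G and [inr v] is its pendant neighbour v'. *)
Definition pendant_edge : rel (G + G)%type := fun x y =>
  match x, y with
  | inl u, inl v => edge u v
  | inl u, inr v => u == v
  | inr u, inl v => u == v
  | inr _, inr _ => false
  end.

Lemma pendant_edge_sym : symmetric pendant_edge.
Proof. by case=> u [] v //=; [apply: edge_sym | apply: eq_sym ..]. Qed.

Lemma pendant_edge_irr : irreflexive pendant_edge.
Proof. by case=> u //=; apply: edge_irr. Qed.

Lemma pendant_nonempty : (0 < #|{: G + G}|)%N.
Proof. by rewrite card_sum addn_gt0 vertex_nonempty. Qed.

Definition pendant_graph : graph :=
  Graph pendant_edge_sym pendant_edge_irr pendant_nonempty.

End Pendant.

Definition log_concave (R : realDomainType) (a : seq R) : Prop :=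
  forall i : nat, (1 <= i)%N -> (i.+1 < size a)%N ->
    a`_i.-1 * a`_i.+1 <= a`_i ^+ 2.

(* [polyseq p] lists the coefficients of p up to its leading one. *)
Definition log_concave_poly (R : realDomainType) (p : {poly R}) : Prop :=
  log_concave (polyseq p).

(* Main.v *)
(** A stable set of the pendant graph is a stable set S of G together with
    pendant vertices away from S, so with n = |G| its independence polynomial has coefficients
    t_k = sum_j s_j C(n-j, k-j).  Put b_j = s_j / C(n,j), which lies in [0,1];
    since C(n,j) C(n-j,k-j) = C(n,k) C(k,j), this reads t_k = C(n,k) P(k) with
    P(k) = 1 + k + b_2 C(k,2) + b_3 C(k,3), as s_0 = 1, s_1 = n and s_j = 0 for
    j > 3.  Now P need not be log-concave, but
    k P(k-1) P(k+1) <= (k+1) P(k)^2, and the lost factor (k+1)/k is regained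
    from the binomials: (k+1) C(n,k-1) C(n,k+1) <= k C(n,k)^2. *)
Require Import Defs.
From mathcomp Require Import all_boot all_order all_algebra.
From mathcomp Require Import ring lra.
Set Implicit Arguments.
Unset Strict Implicit.
Unset Printing Implicit Defensive.
Import Order.TTheory GRing.Theory Num.Theory.

(** Multiplied by [j! (k-j)! (n-k)!], both sides become [n!]; for [n < k] both vanish. *)
Lemma mul_bin_trinomial n k j :
  j <= k -> 'C(n, j) * 'C(n - j, k - j) = 'C(n, k) * 'C(k, j).
Proof.
move=> le_jk; have [le_kn|lt_nk] := leqP k n; last first.
  rewrite (bin_small lt_nk) mul0n; apply/eqP; rewrite muln_eq0.
  have [lt_nj|le_jn] := ltnP n j; first by rewrite bin_small.
  by rewrite (@bin_small (n - j)) ?orbT // ltn_sub2r // (leq_ltn_trans le_jn).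
have le_jn := leq_trans le_jk le_kn.
have f_gt0 : 0 < j`! * (k - j)`! * (n - k)`! by rewrite !muln_gt0 !fact_gt0.
apply/eqP; rewrite -(eqn_pmul2r f_gt0); apply/eqP.
have := bin_fact (leq_sub2r j le_kn).
rewrite subnBA // subnK // => eq1.
transitivity n`!; last first.
  by rewrite -(bin_fact le_kn) -(bin_fact le_jk) !mulnA.
rewrite -(bin_fact le_jn) -eq1 !mulnA.
by rewrite -!mulnA; congr muln; rewrite mulnCA.
Qed.

(** Absorption, [(m+1) C(n,m+1) = (n-m) C(n,m)], turns both sides into multiples of
    [C(n,k) C(n,k+1)], with factors [n-k-1] and [n-k]. *)
Lemma mul_bin_pred_succ_le n k :
  k.+2 * ('C(n, k) * 'C(n, k.+2)) <= k.+1 * 'C(n, k.+1) ^ 2.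
Proof.
rewrite mulnCA mul_bin_left expnS expn1 (mulnA k.+1) mul_bin_left.
by rewrite mulnCA mulnA leq_mul2r leq_mul2r leq_sub2l ?orbT.
Qed.

Section StableCount.
Variable G : graph.

Lemma num_stable_le_bin j : num_stable G j <= 'C(#|G|, j).
Proof.
rewrite -(cardsT G) -cards_draws; apply/subset_leq_card/subsetP => S.
by rewrite !inE subsetT => /andP[].
Qed.

Lemma num_stable_gt_stability j : stability_number G < j -> num_stable G j = 0.
Proof.
move=> lt_j; apply/eqP; rewrite cards_eq0; apply/eqP/setP => S; rewrite !inE.
apply/negP => /andP[stS /eqP cS].
move: lt_j; rewrite -cS ltnNge.
by rewrite (leq_bigmax_cond (F := fun A : {set G} => #|A|) S stS).
Qed.

Lemma num_stable0 : num_stable G 0 = 1.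
Proof.
rewrite /num_stable (_ : [set _ | _] = [set set0]) ?cards1 //.
apply/setP => S; rewrite !inE cards_eq0.
have [->|//] := eqVneq S set0; rewrite ?andbF //.
by rewrite andbT; apply/forall_inP => u; rewrite inE.
Qed.

Lemma num_stable1 : num_stable G 1 = #|G|.
Proof.
rewrite -[RHS](bin1 #|G|) -(cardsT G) -cards_draws; apply: eq_card => S.
rewrite !inE subsetT andTb; case: cards1P => [[x ->]|]; last by rewrite andbF.
rewrite andbT; apply/forall_inP => u /set1P->; apply/forall_inP => v /set1P->.
by rewrite edge_irr.
Qed.

Let join (p : {set G} * {set G}) : {set pendant_graph G} :=
  [set z | match z with inl u => u \in p.1 | inr u => u \in p.2 end].

Let join_bij : bijective join.
Proof.
exists (fun T : {set G + G} => ([set u | inl u \in T], [set u | inr u \in T])).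
  by case=> S W; congr (_, _); apply/setP => u; rewrite !inE.
by move=> T; apply/setP => -[] u; rewrite !inE.
Qed.

Let card_join p : #|join p| = #|p.1| + #|p.2|.
Proof.
rewrite -[#|p.1|](card_imset _ (@inl_inj G G)).
rewrite -[#|p.2|](card_imset _ (@inr_inj G G)).
rewrite -cardsUI [X in _ + X](_ : _ = 0) ?addn0; last first.
  apply/eqP; rewrite cards_eq0; apply/eqP/setP => z; rewrite !inE.
  by apply/negP => /andP[/imsetP[x _ ->] /imsetP[]].
apply: eq_card => -[] u; rewrite !inE.
  rewrite (mem_imset _ _ (@inl_inj G G)).
  by case: imsetP => [[]|] // _; rewrite orbF.
rewrite (mem_imset _ _ (@inr_inj G G)).
by case: (imsetP (D := mem p.1)) => [[]|].
Qed.

Let stable_join p : stable (join p) = stable p.1 && (p.2 \subset ~: p.1).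
Proof.
apply/idP/andP => [st|[st /subsetP sub]].
  have st2 x y : x \in join p -> y \in join p -> ~~ pendant_edge x y.
    by move=> xj yj; have/forall_inP/(_ x xj)/forall_inP/(_ y yj) := st.
  split; last first.
    apply/subsetP => u up2; rewrite inE; apply/negP => up1.
    by have := st2 (inl u) (inr u); rewrite !inE /= eqxx => /(_ up1 up2).
  apply/forall_inP => u up; apply/forall_inP => v vp.
  by apply: (st2 (inl u) (inl v)); rewrite inE.
apply/forall_inP => -[] u; rewrite inE => up; apply/forall_inP => -[] v;
  rewrite inE => vp //=.
- by have/forall_inP/(_ u up)/forall_inP/(_ v vp) := st.
- by apply/negP => /eqP eq_uv; have := sub v vp; rewrite inE -eq_uv up.
- by apply/negP => /eqP eq_uv; have := sub u up; rewrite inE eq_uv vp.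
Qed.

(** Group the stable sets by the size [j] of their part [S] in [G]: the other [k-j] vertices are any
    pendants over the complement of [S]. *)
Lemma num_stable_pendant k :
  num_stable (pendant_graph G) k =
  \sum_(j < k.+1) num_stable G j * 'C(#|G| - j, k - j).
Proof.
rewrite /num_stable -sum1_card (reindex join) /=; last exact: onW_bij.
under eq_bigl do rewrite inE stable_join card_join -andbA.
rewrite -(pair_big_dep (fun S : {set G} => stable S)
  (fun S W : {set G} => (W \subset ~: S) && (#|S| + #|W| == k))
  (fun _ _ => 1)) /=.
(* Sets larger than [k] contribute nothing. They go first because [inord] below would send their
   sizes to the default index 0. *)
rewrite (bigID (fun S : {set G} => #|S| < k.+1)) /= [X in _ + X]big1 ?addn0;
  last first.
  move=> S /andP[_]; rewrite ltnS -ltnNge => lt_k; apply: big1 => W.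
  by move=> /andP[_ /eqP eq_k]; move: lt_k; rewrite -eq_k ltnNge leq_addr.
rewrite (partition_big (fun S : {set G} => inord #|S| : 'I_k.+1) xpredT) //=.
apply: eq_bigr => j _; rewrite -sum_nat_const.
apply: eq_big => [S|S /andP[/andP[_ le_k] /eqP<-]].
  rewrite inE; case: (stable S) => //=; apply/andP/eqP => [[le_k /eqP<-]|->].
    by rewrite inordK.
  by rewrite ltn_ord inord_val.
rewrite inordK // [RHS](_ : _ = 'C(#|~: S|, k - #|S|)); last first.
  by rewrite [#|~: S|]cardsCs setCK.
rewrite -cards_draws sum1_card; apply: eq_card => W; rewrite !inE.
by rewrite -(eqn_add2l #|S|) subnKC.
Qed.

End StableCount.

Local Open Scope ring_scope.

(* [0 <= x * (x - 1)] is all that is used of x being a natural number: it makes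
   the coefficients of [b * c] and [c ^+ 2] nonnegative. *)
Lemma cubic_log_concave_slack (F : realFieldType) (x b c : F) :
  let P y := 1 + y + b * (y * (y - 1) / 2) + c * (y * (y - 1) * (y - 2) / 6) in
  0 <= x -> 0 <= x * (x - 1) -> 0 <= b <= 1 -> 0 <= c <= 1 ->
  (x + 1) * (P x * P (x + 2)) <= (x + 2) * P (x + 1) ^+ 2.
Proof.
move=> P x0 xx /andP[b0 b1] /andP[c0 c1]; rewrite -subr_ge0.
pose k := x + 1; pose u := k * x.
have k0 : 0 <= k by rewrite /k; lra.
have u0 : 0 <= u by rewrite mulr_ge0.
have -> : (x + 2) * P (x + 1) ^+ 2 - (x + 1) * (P x * P (x + 2)) =
  (k ^+ 2 + 3 * k + 1 + b * (k * (k ^+ 2 + k - 3)) + c * (u * (u - 8) / 3))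
  + b ^+ 2 * (k ^+ 2 * (k + 1) * x) / 4
  + b * c * (k ^+ 2 * (k + 1) * (x * (x - 1))) / 6
  + c ^+ 2 * (k ^+ 2 * (k + 1) * x * (x * (x - 1))) / 36.
  by rewrite /P /u /k; field.
(* Here [k^2 + k - 3 = x (x+3) - 1], and only the [-1] can hurt. *)
have bk : - k <= b * (k * (k ^+ 2 + k - 3)).
  have : 0 <= b * (k * (x * (x + 3))) by rewrite !mulr_ge0 // addr_ge0.
  have : 0 <= (1 - b) * k by rewrite mulr_ge0 // ?subr_ge0 //; lra.
  by rewrite /k; lra.
(* Completing the square: [u (u-8) / 3 = (u - 5/2)^2 / 3 - (u + 25/12)]. The shift [5/2] makes the
   loss linear in [u] with slope 1, so that [k^2] absorbs it: [u = k^2 - k]. *)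
have cu : - (u + 25 / 12) <= c * (u * (u - 8) / 3).
  have : 0 <= c * (u - 5 / 2) ^+ 2 by rewrite mulr_ge0 // sqr_ge0.
  have : 0 <= (1 - c) * (u + 25 / 12) by rewrite mulr_ge0 // ?subr_ge0 //; lra.
  by lra.
have lin : 0 <= k ^+ 2 + 3 * k + 1 - k - (u + 25 / 12) by rewrite /u /k; lra.
have k1 : 0 <= k + 1 by lra.
set M := (X in X + _ + _ + _); have : 0 <= M by rewrite /M; lra.
move: M (x * (x - 1)) xx => M w w0 M0.
by rewrite !addr_ge0 ?divr_ge0 ?mulr_ge0 ?exprn_ge0.
Qed.

Lemma bin2_natr (F : numFieldType) k :
  'C(k, 2)%:R = k%:R * (k%:R - 1) / 2 :> F.
Proof.
elim: k => [|k IH]; first by rewrite bin0n !mul0r.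
by rewrite binS natrD IH bin1 -natr1; field.
Qed.

Lemma bin3_natr (F : numFieldType) k :
  'C(k, 3)%:R = k%:R * (k%:R - 1) * (k%:R - 2) / 6 :> F.
Proof.
elim: k => [|k IH]; first by rewrite bin0n !mul0r.
by rewrite binS natrD IH bin2_natr -natr1; field.
Qed.

Theorem theorem4 (R : realDomainType) (G : graph) :
  (stability_number G <= 3)%N ->
  log_concave_poly (independence_poly R (pendant_graph G)).
Proof.
move=> alpha3 [//|i] _ lt_i.
set H := pendant_graph G; pose n := #|G|.
(* Within the coefficient list the cutoff at the stability number of [H] is invisible, so that
   number is never computed. *)
have coefE k : (k < size (independence_poly R H))%N ->
    (independence_poly R H)`_k = (num_stable H k)%:R.
  by move=> lt_k; rewrite coef_poly (leq_trans lt_k) // size_poly.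
rewrite !coefE //; last 2 first.
- exact: ltnW.
- by rewrite /= ltnW // ltnW.
(* [R] may lack inverses; the inequality passes through the naturals to [rat], where the ratios
   [b j] exist. *)
rewrite /= -natrM -natrX ler_nat -(ler_nat rat) natrM natrX.
pose b j : rat := (num_stable G j)%:R / 'C(n, j)%:R.
(* If [C(n,j) = 0], then [s_j = 0] too, so the convention for division by zero does no harm. *)
have bP j : (num_stable G j)%:R = b j * 'C(n, j)%:R.
  have [C0|C_neq0] := eqVneq ('C(n, j)%:R : rat) 0; last by rewrite divfK.
  move/eqP: C0 (num_stable_le_bin G j); rewrite -/n pnatr_eq0 => /eqP ->.
  by rewrite leqn0 mulr0 => /eqP->.
have b01 j : 0 <= b j <= 1.
  rewrite divr_ge0 ?ler0n //=.
  have [C0|C_neq0] := eqVneq ('C(n, j)%:R : rat) 0.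
    by rewrite /b C0 invr0 mulr0 ler01.
  by rewrite ler_pdivrMr ?lt0r ?C_neq0 ?ler0n // mul1r ler_nat
    num_stable_le_bin.
pose P y : rat :=
  1 + y + b 2%N * (y * (y - 1) / 2) + b 3%N * (y * (y - 1) * (y - 2) / 6).
have tE k : (num_stable H k)%:R = 'C(n, k)%:R * P k%:R.
  rewrite num_stable_pendant natr_sum.
  (* The padded range can be cut at [j <= k], where [C(k,j)] dies out, or at [j <= 3], where [b j]
     does. *)
  transitivity ('C(n, k)%:R * \sum_(j < 4 + k.+1) b j * 'C(k, j)%:R).
    rewrite addnC big_split_ord /= [X in _ * (_ + X)]big1 ?addr0; last first.
      by move=> j _; rewrite bin_small ?mulr0 //= leq_addr.
    rewrite mulr_sumr; apply: eq_bigr => j _.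
    rewrite natrM bP -mulrA -natrM mul_bin_trinomial -1?ltnS //.
    by rewrite natrM mulrCA.
  rewrite big_split_ord /= [X in _ * (_ + X)]big1 ?addr0; last first.
    move=> j _; rewrite /b num_stable_gt_stability ?mul0r //.
    by rewrite (leq_ltn_trans alpha3) // addSn ltnS leq_addr.
  congr (_ * _); rewrite !big_ord_recr big_ord0 /= add0r.
  rewrite bin2_natr bin3_natr bin0 bin1 /b num_stable0 num_stable1 bin0 bin1.
  have n_neq0 : n%:R != 0 :> rat by rewrite pnatr_eq0 -lt0n vertex_nonempty.
  by rewrite divr1 (divff n_neq0) !mul1r.
have slack : i.+1%:R * (P i%:R * P i.+2%:R) <= i.+2%:R * P i.+1%:R ^+ 2.
  have -> : i.+1%:R = i%:R + 1 :> rat by rewrite natr1.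
  have -> : i.+2%:R = i%:R + 2 :> rat by rewrite -natrD addn2.
  apply: cubic_log_concave_slack => //.
  by case: (i) => [|m]; rewrite ?mul0r // -natr1 addrK mulr_ge0 // ?natr1 ler0n.
have P_ge0 m : 0 <= P m%:R.
  rewrite /P -bin2_natr -bin3_natr.
  have [/andP[? _] /andP[? _]] := (b01 2%N, b01 3%N).
  by rewrite !addr_ge0 // mulr_ge0.
(* The middle index is [i+1]. After scaling by [i+2], the binomial bound trades that factor for
   [i+1], and [slack] trades it back. *)
rewrite !tE -(ler_pM2l (ltr0Sn _ i.+1)).
apply: (@le_trans _ _ (i.+1%:R * 'C(n, i.+1)%:R ^+ 2 * (P i%:R * P i.+2%:R))).
  rewrite [X in i.+2%:R * X]mulrACA [leLHS]mulrA ler_wpM2r ?mulr_ge0 //.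
  by rewrite -natrX -!natrM ler_nat mul_bin_pred_succ_le.
rewrite exprMn [leLHS]mulrAC [leLHS]mulrC [leRHS]mulrCA.
by rewrite ler_wpM2l // exprn_ge0 ?ler0n.
Qed.
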